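(* Let $\hat g\colon M_n\to\mathbb{R}$ be a real-valued function on $M_n=\{(x_1,\dots,x_n)\in(0,\infty)^n : x_1\geq\dots\geq x_n\}$, and let $W\colon\mathrm{GL}^+(n)\to\mathbb{R}$ be given by $W(F)=\hat g(\hat\lambda_1(F),\dots,\hat\lambda_n(F))$, where $\hat\lambda_1(F)\geq\dots\geq\hat\lambda_n(F)$ are the ordered singular values of $F$. If $\hat g\in C^2(M_n)$ and $W$ is Legendre-Hadamard elliptic at each $F\in\mathrm{GL}^+(n)$ with simple singular values $\hat\lambda_1(F)>\dots>\hat\lambda_n(F)$, then $W$ is rank-one convex on $\mathrm{GL}^+(n)$.
   Context: $\mathrm{GL}^+(n)$ is the group of real invertible $n\times n$ matrices with positive determinant. $\hat g\in C^2(M_n)$ means $\hat g$ is twice continuously differentiable on $M_n$ up to its boundary relative to $(0,\infty)^n$ (the ordered vectors whose entries are not all distinct), i.e. it is the restriction of a $C^2$ function on an open neighbourhood of $M_n$ in $(0,\infty)^n$. A function $W\colon\mathrm{GL}^+(n)\to\mathbb{R}$ is rank-one convex if for all $F_1,F_2\in\mathrm{GL}^+(n)$ with $\operatorname{rank}(F_2-F_1)=1$ and all $t\in[0,1]$, $W((1-t)F_1+tF_2)\leq(1-t)W(F_1)+tW(F_2)$. $W$ is Legendre-Hadamard elliptic at $F$ if $W$ is twice differentiable at $F$ and $D^2W[F].(\xi\otimes\eta,\xi\otimes\eta)\geq0$ for all $\xi,\eta\in\mathbb{R}^n$. *)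

(* Defs.v *)
From HB Require Import structures.
From mathcomp Require Import all_boot all_order all_algebra.
From mathcomp Require Import all_classical all_reals all_analysis.
Set Implicit Arguments. Unset Strict Implicit. Unset Printing Implicit Defensive.
Import Order.TTheory GRing.Theory Num.Theory.
Import numFieldNormedType.Exports.
Local Open Scope classical_set_scope.
Local Open Scope ring_scope.

Definition GLp (R : realType) (n : nat) : set 'M[R]_n :=
  [set F | 0 < \det F].

Definition posorthant (R : realType) (n : nat) : set 'rV[R]_n :=
  [set x | forall i : 'I_n, 0 < x ord0 i].

Definition Mn (R : realType) (n : nat) : set 'rV[R]_n :=
  [set x | posorthant x /\ forall i j : 'I_n, (i <= j)%N -> x ord0 j <= x ord0 i].

Definition is_svals (R : realType) (n : nat) (F : 'M[R]_n) (lam : 'rV[R]_n) :=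
  (forall i : 'I_n, 0 <= lam ord0 i) /\
  (forall i j : 'I_n, (i <= j)%N -> lam ord0 j <= lam ord0 i) /\
  exists U V : 'M[R]_n,
    [/\ U *m U^T = 1%:M, V *m V^T = 1%:M & F = U *m diag_mx lam *m V^T].

Definition svals (R : realType) (n : nat) (F : 'M[R]_n) : 'rV[R]_n :=
  xget 0 (is_svals F).

Definition simple_svals (R : realType) (n : nat) (F : 'M[R]_n) :=
  forall i j : 'I_n, (i < j)%N -> svals F ord0 j < svals F ord0 i.

(* f is C^2 on the open set O: all first and second directional
   (equivalently partial) derivatives exist on O and are continuous on O. *)
Definition C2_on (R : realType) (n : nat) (O : set 'rV[R]_n) (f : 'rV[R]_n -> R) :=
  (forall x, O x -> forall v w : 'rV[R]_n,
      derivable f x v /\ derivable ('D_v f) x w) /\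
  (forall v w : 'rV[R]_n,
      {within O, continuous ('D_v f)} /\ {within O, continuous ('D_w ('D_v f))}).

Definition C2_Mn (R : realType) (n : nat) (g : 'rV[R]_n -> R) :=
  exists (O : set 'rV[R]_n) (G : 'rV[R]_n -> R),
    [/\ open O, @Mn R n `<=` O, O `<=` @posorthant R n,
        C2_on O G & forall x, @Mn R n x -> G x = g x].

(* W twice (Frechet) differentiable at F: differentiable near F and the
   derivative G |-> DW[G] is differentiable at F (tested on each direction,
   which is equivalent in finite dimension). *)
Definition twice_differentiable_at (R : realType) (n : nat)
  (W : 'M[R]_n -> R) (F : 'M[R]_n) :=
  (\forall G \near F, differentiable W G) /\
  forall H : 'M[R]_n, differentiable (fun G => 'd W G H) F.

Definition D2 (R : realType) (n : nat) (W : 'M[R]_n -> R) (F H K : 'M[R]_n) : R :=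
  'd (fun G => 'd W G H) F K.

Definition LH_elliptic_at (R : realType) (n : nat) (W : 'M[R]_n -> R) (F : 'M[R]_n) :=
  twice_differentiable_at W F /\
  forall xi eta : 'cV[R]_n, 0 <= D2 W F (xi *m eta^T) (xi *m eta^T).

Definition rank_one_convex (R : realType) (n : nat) (W : 'M[R]_n -> R) :=
  forall F1 F2 : 'M[R]_n, @GLp R n F1 -> @GLp R n F2 -> \rank (F2 - F1) = 1%N ->
  forall t : R, 0 <= t <= 1 ->
    W ((1 - t) *: F1 + t *: F2) <= (1 - t) * W F1 + t * W F2.

(* Main.v *)
(** Along a segment with rank-one direction [H], the determinant is affine, hence
positive, so [W] would be convex there if all singular values on the segment were
simple. The matrices with a multiple singular value have codimension two, hence a
generic line parallel to [H] avoids them; as [W] is continuous (singular values are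
continuous by Weyl's inequality), the convexity inequality passes to the limit.

Genericity is made explicit as follows. For [H = xi eta^T] with [|eta| = 1] and
[P = 1 - eta eta^T], the matrices [F(t) = F + t H] satisfy
[F(t) F(t)^T = (F P) (F P)^T + c(t) c(t)^T] with [c(t) = F eta + t xi], a rank-one
update of a fixed matrix. If that matrix has distinct eigenvalues [d], then in its
eigenbasis a multiple eigenvalue at time [t] forces, for some [i], both [c_i(t) = 0]
and [1 + sum_(j != i) c_j(t)^2 / (d_j - d_i) = 0]. Successive small perturbations of
[F] make [d] injective, the coordinates of [F eta] nonzero, and (by rescaling
[F eta]) the two conditions incompatible. *)

Require Import Defs.
From HB Require Import structures.
From mathcomp Require Import all_boot all_order all_algebra.
From mathcomp Require Import all_classical all_reals all_analysis.
From mathcomp Require Import ring lra.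
Import Order.TTheory GRing.Theory Num.Theory.
Import numFieldNormedType.Exports.
Local Open Scope ring_scope.

Set Implicit Arguments.
Unset Strict Implicit.

(** * Euclidean inner product of column vectors *)

Section InnerProduct.
Variables (R : realType) (n : nat).
Implicit Types (x y z : 'cV[R]_n) (A : 'M[R]_n).

Definition dotc x y : R := \sum_i x i 0 * y i 0.

Lemma mul_tr_cV x y : x^T *m y = (dotc x y)%:M.
Proof.
by rewrite [LHS]mx11_scalar mxE; congr _%:M; apply: eq_bigr => i _; rewrite mxE.
Qed.

Lemma dotcC x y : dotc x y = dotc y x.
Proof. by apply: eq_bigr => i _; rewrite mulrC. Qed.

Lemma dotcDr x y z : dotc x (y + z) = dotc x y + dotc x z.
Proof. by rewrite -big_split; apply: eq_bigr => i _; rewrite mxE mulrDr. Qed.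

Lemma dotcZr a x y : dotc x (a *: y) = a * dotc x y.
Proof. by rewrite big_distrr; apply: eq_bigr => i _; rewrite mxE mulrCA. Qed.

Lemma dotcBr x y z : dotc x (y - z) = dotc x y - dotc x z.
Proof. by rewrite dotcDr -scaleN1r dotcZr mulN1r. Qed.

Lemma dotcDl x y z : dotc (x + y) z = dotc x z + dotc y z.
Proof. by rewrite dotcC dotcDr !(dotcC z). Qed.

Lemma dotcZl a x y : dotc (a *: x) y = a * dotc x y.
Proof. by rewrite dotcC dotcZr dotcC. Qed.

Lemma dotc_mulmx A x y : dotc x (A *m y) = dotc (A^T *m x) y.
Proof.
have /matrixP/(_ 0 0) : x^T *m (A *m y) = (A^T *m x)^T *m y.
  by rewrite trmx_mul trmxK mulmxA.
by rewrite !mul_tr_cV !mxE eqxx !mulr1n.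
Qed.

Lemma dotc_ge0 x : 0 <= dotc x x.
Proof. by apply: sumr_ge0 => i _; rewrite -expr2 sqr_ge0. Qed.

Lemma dotc_eq0 x : dotc x x = 0 -> x = 0.
Proof.
move=> x0; apply/colP => i; rewrite mxE; apply/eqP.
have /psumr_eq0P := x0; rewrite -sqrf_eq0 expr2 => -> // j _.
by rewrite -expr2 sqr_ge0.
Qed.

Lemma dotc_gt0 x : x != 0 -> 0 < dotc x x.
Proof.
by move=> x0; rewrite lt_def dotc_ge0 andbT; apply: contra_neq x0; exact: dotc_eq0.
Qed.

Lemma dotc_orth U x y : U *m U^T = 1%:M -> dotc (U^T *m x) (U^T *m y) = dotc x y.
Proof. by move=> UU; rewrite dotc_mulmx trmxK mulmxA UU mul1mx. Qed.

Lemma dotc_diag (d : 'rV[R]_n) x :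
  dotc x (diag_mx d *m x) = \sum_i d 0 i * x i 0 ^+ 2.
Proof.
by apply: eq_bigr => i _; rewrite mul_diag_mx mxE mulrCA expr2.
Qed.

Lemma dotc_spectral (U A : 'M[R]_n) (d : 'rV[R]_n) x :
  A = U *m diag_mx d *m U^T ->
  dotc x (A *m x) = \sum_i d 0 i * (U^T *m x) i 0 ^+ 2.
Proof.
by move=> ->; rewrite -!mulmxA dotc_mulmx dotc_diag.
Qed.

End InnerProduct.

(** * Spectral theorem for real symmetric matrices *)

Section Spectral.
Variable R : realType.

Lemma orthC n (U : 'M[R]_n) : U *m U^T = 1%:M -> U^T *m U = 1%:M.
Proof. exact: mulmx1C. Qed.

Lemma continuous_sum n (T : topologicalType) (f : 'I_n -> T -> R) :
  (forall i, continuous (f i)) -> continuous (fun x => \sum_i f i x).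
Proof.
move=> cf; apply: continuous_big => [x|i _]; last exact: cf.
exact: add_continuous.
Qed.

Lemma sphere_compact n : compact [set v : 'rV[R]_n | \sum_i v 0 i ^+ 2 = 1]%classic.
Proof.
apply: bounded_closed_compact.
  exists 1; split => // M M1 v /= v1; apply/ltW/(le_lt_trans _ M1).
  rewrite [leLHS]/Num.Def.normr /= mx_normrE; apply/bigmax_leP; split => // -[i j] _ /=.
  rewrite ord1 -(@ler_pXn2r _ 2) ?nnegrE// real_normK ?num_real// expr1n -v1.
  by rewrite (bigD1 j)//= lerDl sumr_ge0// => k _; rewrite sqr_ge0.
have -> : [set v : 'rV[R]_n | \sum_i v 0 i ^+ 2 = 1]%classic =
  ((fun v : 'rV[R]_n => \sum_i v 0 i ^+ 2) @^-1` [set 1])%classic by [].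
apply: preimage_closed; last exact: closed_eq.
move=> v _; apply: continuous_sum => i {}v.
by apply: (@continuousM _ _ (fun v : 'rV[R]_n => v 0 i) (fun v : 'rV[R]_n => v 0 i));
  exact: coord_continuous.
Qed.

(** A maximiser of the quadratic form on the compact unit sphere is an eigenvector. The global bound
    records that [a] is the top eigenvalue, which later yields the decreasing order of the
    spectrum. *)
Lemma sym_max_eigen n (A : 'M[R]_n.+1) : A^T = A ->
  exists (a : R) (v : 'cV[R]_n.+1), [/\ dotc v v = 1, A *m v = a *: v &
    forall x, dotc x (A *m x) <= a * dotc x x].
Proof.
move=> symA.
pose f (v : 'rV[R]_n.+1) := \sum_i v 0 i * \sum_j A i j * v 0 j.
have fE v : f v = dotc v^T (A *m v^T).
  apply: eq_bigr => i _; rewrite mxE; congr (_ * _).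
  by rewrite mxE; apply: eq_bigr => j _; rewrite mxE.
have cf : continuous f.
  apply: continuous_sum => i v.
  apply: (@continuousM _ _ (fun v : 'rV[R]_n.+1 => v 0 i)).
    exact: coord_continuous.
  apply: continuous_sum => j {}v.
  apply: (@continuousM _ _ (fun=> A i j) (fun v : 'rV[R]_n.+1 => v 0 j)).
    exact: cst_continuous.
  exact: coord_continuous.
have [|c c1 cmax] := EVT_max_rV _ (@sphere_compact n.+1) (continuous_subspaceT cf).
  exists (delta_mx 0 0) => /=; rewrite (bigD1 0)//= big1 => [|i i0].
    by rewrite mxE eqxx expr1n addr0.
  by rewrite mxE (negbTE i0) andbF expr0n.
have sqE (x : 'cV[R]_n.+1) : dotc x x = \sum_i x^T 0 i ^+ 2.
  by apply: eq_bigr => i _; rewrite mxE expr2.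
have {}c1 : dotc c^T c^T = 1 by rewrite sqE trmxK; move: c1; rewrite inE.
have max x : dotc x (A *m x) <= f c * dotc x x.
  have [->|x0] := eqVneq x 0.
    by rewrite mulmx0 -[X in dotc X](scale0r 0) !dotcZl !mul0r mulr0.
  have xx0 := dotc_gt0 x0.
  pose s := Num.sqrt (dotc x x).
  have s0 : 0 < s by rewrite sqrtr_gt0.
  have sE : s ^+ 2 = dotc x x by rewrite sqr_sqrtr// ltW.
  have := cmax (s^-1 *: x)^T; rewrite inE/= -sqE dotcZl dotcZr -sE.
  rewrite fE trmxK -scalemxAr dotcZl dotcZr.
  have -> : s^-1 * (s^-1 * s ^+ 2) = 1 by field; rewrite gt_eqF.
  move=> /(_ erefl); rewrite mulrA -invfM -expr2 ler_pdivrMl ?exprn_gt0//.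
  by rewrite mulrC.
exists (f c), c^T; split => //.
have [w wE] : exists w, w = f c *: c^T - A *m c^T by eexists.
suff /dotc_eq0/eqP : dotc w w = 0 by rewrite wE subr_eq0 => /eqP ->.
apply/eqP; rewrite eq_le dotc_ge0 andbT leNgt; apply/negP => w0.
(* first-order optimality of [c] in the direction [w] *)
have quad t : 0 <= t * dotc w w *+ 2 + t ^+ 2 * (f c * dotc w w - dotc w (A *m w)).
  have := max (c^T + t *: w); rewrite -subr_ge0; congr (0 <= _).
  rewrite mulmxDr -scalemxAr !dotcDl !dotcDr !dotcZl !dotcZr -fE c1.
  rewrite (dotc_mulmx A c^T) symA (dotcC (A *m _) w).
  have -> : dotc w w = f c * dotc w c^T - dotc w (A *m c^T).
    by rewrite {2}wE dotcBr dotcZr.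
  rewrite (dotcC c^T w); ring.
set b := f c * _ - _ in quad.
(* The quadratic in [quad] vanishes at 0 with slope [2 * dotc w w > 0], so it is negative somewhere
   to the left: at [- 1] if [b <= 0], at its vertex otherwise. *)
have [b0|b0] := leP b 0.
  by have := quad (- 1); nra.
have := quad (- (dotc w w / b)).
have -> : - (dotc w w / b) * dotc w w *+ 2 + (- (dotc w w / b)) ^+ 2 * b =
  - (dotc w w ^+ 2 / b) by field; rewrite gt_eqF.
by rewrite oppr_ge0 leNgt divr_gt0// exprn_gt0.
Qed.

(* Householder reflection *)
Lemma orth_first_col n (v : 'cV[R]_n.+1) : dotc v v = 1 ->
  exists Q : 'M[R]_n.+1, Q *m Q^T = 1%:M /\ Q *m delta_mx 0 0 = v.
Proof.
move=> v1; set e : 'cV[R]_n.+1 := delta_mx 0 0.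
have [->|ve] := eqVneq v e.
  by exists 1%:M; rewrite trmx1 !mul1mx.
have de x : dotc x e = x 0 0.
  rewrite /dotc (bigD1 0)//= big1 => [|i i0]; first by rewrite mxE !eqxx mulr1 addr0.
  by rewrite mxE (negbTE i0) mulr0.
have e00 : e 0 0 = 1 by rewrite mxE !eqxx.
pose w := v - e; pose s := dotc w w.
have s0 : s != 0 by rewrite gt_eqF// dotc_gt0// subr_eq0.
have we : dotc w e = - (s / 2).
  have : s = 2 - 2 * v 0 0.
    rewrite /s /w -scaleN1r !dotcDl !dotcDr !dotcZl !dotcZr v1 (dotcC e v) !de.
    by rewrite e00; ring.
  by move=> ->; rewrite de /w mxE [(- e) 0 0]mxE e00; field.
exists (1%:M - (2 / s) *: (w *m w^T)).
have -> : (1%:M - (2 / s) *: (w *m w^T))^T = 1%:M - (2 / s) *: (w *m w^T).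
  by rewrite linearB linearZ /= trmx1 trmx_mul trmxK.
split.
  have MM : w *m w^T *m (w *m w^T) = s *: (w *m w^T).
    by rewrite -mulmxA (mulmxA w^T) mul_tr_cV mul_scalar_mx -scalemxAr.
  rewrite mulmxBl mul1mx mulmxBr mulmx1 -scalemxAl -scalemxAr MM !scalerA.
  rewrite -addrA -[RHS]addr0; congr (_ + _); rewrite -scalerBl -scaleNr -scalerBl.
  by rewrite [X in X *: _](_ : _ = 0) ?scale0r//; field; rewrite s0.
rewrite mulmxBl mul1mx -scalemxAl -mulmxA mul_tr_cV we scalar_mxC mul_scalar_mx scalerA.
rewrite [X in X *: _](_ : _ = -1); last by field; rewrite s0.
by rewrite scaleN1r opprK addrC subrK.
Qed.

(** Deflation: an orthogonal change of basis taking the first basis vector to a top eigenvector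
    splits off a 1 by 1 block, and induction handles the other block. *)
Theorem sym_spectral n (A : 'M[R]_n) : A^T = A ->
  exists (U : 'M[R]_n) (d : 'rV[R]_n), [/\ U *m U^T = 1%:M,
    A = U *m diag_mx d *m U^T &
    forall i j : 'I_n, (i <= j)%N -> d 0 j <= d 0 i].
Proof.
elim: n A => [|n IHn] A symA.
  exists 1%:M, 0; split; [by rewrite trmx1 mul1mx | | by case].
  by apply/matrixP; case.
have [a [v [v1 Av max]]] := sym_max_eigen symA.
have [Q [QQ Qv]] := orth_first_col v1.
have QtQ := orthC QQ.
have [B BQ] : exists B : 'M[R]_(1 + n), B = Q^T *m A *m Q by eexists.
have symB : B^T = B by rewrite BQ !trmx_mul trmxK symA mulmxA.
have Bcol i : B i 0 = a * (i == 0)%:R.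
  have /colP/(_ i) : Q^T *m A *m Q *m delta_mx 0 0 = a *: delta_mx 0 0 :> 'cV_n.+1.
    by rewrite -mulmxA Qv -mulmxA Av -scalemxAr -Qv mulmxA QtQ mul1mx.
  by rewrite -colE -BQ !mxE andbT.
have BE : B = block_mx a%:M 0 0 (drsubmx B).
  rewrite -[LHS]submxK; congr block_mx.
  - by rewrite [LHS]mx11_scalar !mxE lshift0 Bcol eqxx mulr1.
  - apply/matrixP => i j; rewrite ord1 -symB !mxE lshift0 Bcol.
    by rewrite -val_eqE /= mulr0.
  - apply/matrixP => i j; rewrite ord1 !mxE lshift0 Bcol.
    by rewrite -val_eqE /= mulr0.
have [|U' [d' [UU' B'E sd']]] := IHn (drsubmx B).
  by rewrite trmx_drsub symB.
pose V : 'M[R]_(1 + n) := block_mx 1%:M 0 0 U'.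
have VV : V *m V^T = 1%:M.
  rewrite /V tr_block_mx mulmx_block trmx1 !trmx0 !mulmx0 !mul0mx !mulmx1 addr0 !add0r UU'.
  by rewrite -scalar_mx_block.
pose d : 'rV[R]_(1 + n) := row_mx a%:M d'.
have BV : B = V *m diag_mx d *m V^T.
  rewrite BE B'E /V /d diag_mx_row tr_block_mx !mulmx_block.
  rewrite trmx1 !trmx0 !mulmx0 !mul0mx !mulmx1 !addr0 !add0r.
  rewrite !mul1mx !mul0mx.
  congr block_mx; rewrite ?addr0 ?mul0mx//.
  by apply/matrixP => i j; rewrite !ord1 !mxE eqxx.
have UU : Q *m V *m (Q *m V)^T = 1%:M.
  by rewrite trmx_mul mulmxA -(mulmxA Q) VV mulmx1.
have AE : A = Q *m V *m diag_mx d *m (Q *m V)^T.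
  have -> : Q *m V *m diag_mx d *m (Q *m V)^T = Q *m (V *m diag_mx d *m V^T) *m Q^T.
    by rewrite trmx_mul !mulmxA.
  rewrite -BV BQ.
  by rewrite -!mulmxA QQ mulmx1 !mulmxA QQ mul1mx.
move: (Q *m V) UU AE => U UU AE; exists U, d; split => //.
(* Evaluating [max] at the [j]-th column of [U] bounds [d 0 j] by the eigenvalue split off first. *)
have da j : d 0 j <= a.
  have := max (U *m delta_mx j 0).
  rewrite (dotc_spectral _ AE) -[X in _ <= a * X](dotc_orth _ _ UU).
  rewrite !(mulmxA _^T) (orthC UU) !mul1mx (bigD1 j)//= big1 => [|i ij].
    rewrite addr0 [delta_mx _ _ _ _]mxE !eqxx expr1n mulr1 => /le_trans; apply.
    rewrite /dotc (bigD1 j)//= big1 => [|i ij].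
      by rewrite !mxE !eqxx addr0 !mulr1.
    by rewrite !mxE (negbTE ij) mulr0.
  by rewrite [delta_mx _ _ _ _]mxE (negbTE ij) expr0n mulr0.
have d0 : d 0 0 = a.
  by rewrite -(lshift0 n 0) row_mxEl mxE eqxx.
have dS j : d 0 (rshift 1 j) = d' 0 j by rewrite row_mxEr.
move=> i j; case: (@split_ordP 1 n i) => {}i ->; case: (@split_ordP 1 n j) => {}j ->.
- by rewrite !ord1.
- by move=> _; rewrite ord1 lshift0 d0 da.
- by rewrite /= ord1.
- by rewrite !dS /= leq_add2l; apply: sd'.
Qed.

End Spectral.

(** * Singular values: existence and continuity *)

Section SingularValues.
Variables (R : realType) (n : nat).
Implicit Types (F G A B U V : 'M[R]_n) (d lam : 'rV[R]_n) (x : 'cV[R]_n).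

(* Only [n - 1] linear conditions are imposed on [x]. *)
Lemma flags_meet U U' (k : 'I_n) : exists2 x : 'cV[R]_n, x != 0 &
  (forall i : 'I_n, (k < i)%N -> (U^T *m x) i 0 = 0) /\
  (forall i : 'I_n, (i < k)%N -> (U'^T *m x) i 0 = 0).
Proof.
(* Row [k] is zero, so [M] is singular and its kernel supplies [x]. *)
pose M : 'M[R]_n := \matrix_(i, j)
  (if (i < k)%N then U' j i else if (k < i)%N then U j i else 0).
have : \det M^T == 0.
  rewrite det_tr (expand_det_row _ k) big1// => j _.
  by rewrite mxE ltnn mul0r.
move=> /det0P[v v0 vM]; exists v^T; first by rewrite trmx_eq0.
have Mv i : \sum_j M i j * v 0 j = 0.
  transitivity ((v *m M^T) 0 i); last by rewrite vM mxE.
  by rewrite [RHS]mxE; apply: eq_bigr => j _; rewrite [M^T _ _]mxE mulrC.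
split => i ki; rewrite mxE -[RHS](Mv i); apply: eq_bigr => j _; rewrite !mxE.
  by rewrite ki ltnNge (ltnW ki).
by rewrite ki.
Qed.

(* Weyl's perturbation inequality *)
Lemma spectral_le U U' A B d d' e :
  U *m U^T = 1%:M -> U' *m U'^T = 1%:M ->
  A = U *m diag_mx d *m U^T -> B = U' *m diag_mx d' *m U'^T ->
  (forall i j : 'I_n, (i <= j)%N -> d 0 j <= d 0 i) ->
  (forall i j : 'I_n, (i <= j)%N -> d' 0 j <= d' 0 i) ->
  (forall x, dotc x (A *m x) <= dotc x (B *m x) + e * dotc x x) ->
  forall k, d 0 k <= d' 0 k + e.
Proof.
move=> UU UU' AE BE sd sd' AB k.
(* On this [x] the form of [A] is at least [d 0 k * dotc x x] and that of [B] at most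
   [d' 0 k * dotc x x]. *)
have [x x0 [xU xU']] := flags_meet U U' k.
rewrite -(ler_pM2r (dotc_gt0 x0)) mulrDl.
apply: le_trans (le_trans (AB x) _).
  rewrite (dotc_spectral _ AE) -(dotc_orth _ _ UU) mulr_sumr.
  apply: ler_sum => i _; rewrite -expr2.
  have [ik|ki] := leqP i k; first by rewrite ler_wpM2r ?sqr_ge0// sd.
  by rewrite xU// expr0n !mulr0.
rewrite lerD2r (dotc_spectral _ BE) -(dotc_orth _ _ UU') mulr_sumr.
apply: ler_sum => i _; rewrite -expr2.
have [ki|ik] := leqP k i; first by rewrite ler_wpM2r ?sqr_ge0// sd'.
by rewrite xU'// expr0n !mulr0.
Qed.

Lemma mulmx_diag_sqr lam : diag_mx lam *m (diag_mx lam)^T = diag_mx (\row_i lam 0 i ^+ 2).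
Proof.
by rewrite tr_diag_mx mulmx_diag; congr diag_mx.
Qed.

Lemma svd_gram U V lam F : V *m V^T = 1%:M -> F = U *m diag_mx lam *m V^T ->
  F *m F^T = U *m diag_mx (\row_i lam 0 i ^+ 2) *m U^T.
Proof.
move=> VV ->; rewrite !trmx_mul trmxK -mulmx_diag_sqr.
by rewrite -!mulmxA (mulmxA V^T) (orthC VV) mul1mx.
Qed.

(** Diagonalise [F *m F^T] and take square roots of its eigenvalues. Invertibility makes them
    positive, so [F^T *m U] with its columns divided by the roots is orthogonal and serves as the
    right factor. *)
Lemma svd_exists F : F \in unitmx -> exists lam, is_svals F lam.
Proof.
move=> uF.
have [|U [d [UU FE sd]]] := @sym_spectral R n (F *m F^T).
  by rewrite trmx_mul trmxK.
have d0 i : 0 < d 0 i.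
  pose x := U *m delta_mx i (0 : 'I_1).
  have Ux : U^T *m x = delta_mx i 0 by rewrite mulmxA (orthC UU) mul1mx.
  have <- : dotc x (F *m F^T *m x) = d 0 i.
    rewrite (dotc_spectral _ FE) Ux (bigD1 i)//= big1 => [|j ji].
      by rewrite mxE !eqxx expr1n mulr1 addr0.
    by rewrite mxE (negbTE ji) expr0n mulr0.
  rewrite -mulmxA dotc_mulmx dotc_gt0//; apply/eqP => Fx.
  have uFt : F^T \in unitmx by rewrite unitmx_tr.
  have x0 : x = 0 by rewrite -(mulKmx uFt x) Fx mulmx0.
  move: Ux; rewrite x0 mulmx0 => /colP/(_ i).
  by rewrite !mxE !eqxx => /esym/eqP; rewrite oner_eq0.
pose lam := \row_i Num.sqrt (d 0 i); pose mu := \row_i (Num.sqrt (d 0 i))^-1.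
have s0 i : Num.sqrt (d 0 i) != 0 by rewrite gt_eqF// sqrtr_gt0.
have lm : diag_mx lam *m diag_mx mu = 1%:M.
  rewrite mulmx_diag -diag_const_mx; congr diag_mx; apply/rowP => i.
  by rewrite !mxE mulfV.
have dlam : diag_mx d = diag_mx lam *m diag_mx lam.
  rewrite mulmx_diag; congr diag_mx; apply/rowP => i.
  by rewrite !mxE -expr2 sqr_sqrtr// ltW.
exists lam; split; first by move=> i; rewrite mxE sqrtr_ge0.
split; first by move=> i j ij; rewrite !mxE ler_wsqrtr// sd.
exists U, (F^T *m U *m diag_mx mu); split => //.
  apply: mulmx1C; rewrite !trmx_mul trmxK tr_diag_mx.
  have -> : diag_mx mu *m (U^T *m F) *m (F^T *m U *m diag_mx mu) =
    diag_mx mu *m (U^T *m (F *m F^T) *m U) *m diag_mx mu by rewrite !mulmxA.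
  rewrite FE -[U *m _ *m _]mulmxA [U^T *m _]mulmxA (orthC UU) mul1mx.
  rewrite -[_ *m U^T *m U]mulmxA (orthC UU) mulmx1.
  by rewrite dlam mulmxA (mulmx1C lm) mul1mx lm.
rewrite !trmx_mul trmxK tr_diag_mx !mulmxA -(mulmxA U) lm mulmx1 UU.
by rewrite mul1mx.
Qed.

Lemma svalsP F : 0 < \det F -> is_svals F (svals F).
Proof.
move=> F0; apply: xgetPex; apply: svd_exists.
by rewrite unitmxE unitfE gt_eqF.
Qed.

Lemma svals_gt0 F i : 0 < \det F -> 0 < svals F 0 i.
Proof.
move=> F0; have [ge0 [_ [U [V [_ _ FE]]]]] := svalsP F0.
rewrite lt_def ge0 andbT; apply: contraTneq F0 => l0.
by rewrite FE !det_mulmx det_diag (bigD1 i)//= l0 mul0r mulr0 mul0r ltxx.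
Qed.

Lemma svals_Mn F : 0 < \det F -> Mn (svals F).
Proof.
move=> F0; split; first by move=> i; exact: svals_gt0.
by have [_ []] := svalsP F0.
Qed.

Lemma svals_sqr_le F G e : 0 < \det F -> 0 < \det G ->
  (forall x, dotc x (F *m F^T *m x) <= dotc x (G *m G^T *m x) + e * dotc x x) ->
  forall k, svals F 0 k ^+ 2 <= svals G 0 k ^+ 2 + e.
Proof.
move=> F0 G0 FG k.
have [lF [sF [U [V [UU VV FE]]]]] := svalsP F0.
have [lG [sG [U' [V' [UU' VV' GE]]]]] := svalsP G0.
have := spectral_le UU UU' (svd_gram VV FE) (svd_gram VV' GE) _ _ FG k.
rewrite !mxE; apply => i j ij; rewrite !mxE ler_pXn2r ?nnegrE//.
  exact: sF.
exact: sG.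
Qed.

(** Each product of two coordinates is at most [dotc x x] in absolute value, and there are [n ^ 2]
    of them. This turns entrywise closeness into the form comparison that Weyl's inequality
    takes. *)
Lemma dotc_mulmx_le A e x : (forall i j, `|A i j| <= e) ->
  dotc x (A *m x) <= e * n%:R ^+ 2 * dotc x x.
Proof.
move=> Ae.
have xx i j : `|x i 0| * `|x j 0| <= dotc x x.
  have sq k : x k 0 ^+ 2 <= dotc x x.
    rewrite /dotc (bigD1 k)//= -expr2 lerDl sumr_ge0// => l _.
    by rewrite -expr2 sqr_ge0.
  have := sq i; have := sq j; rewrite -(real_normK (num_real (x i 0))).
  rewrite -(real_normK (num_real (x j 0))).
  have := sqr_ge0 (`|x i 0| - `|x j 0|); nra.
rewrite /dotc.
apply: (@le_trans _ _ (\sum_(i < n) \sum_(j < n) e * dotc x x)); last first.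
  rewrite !sumr_const !card_ord -!mulrnA -[leLHS]mulr_natl natrM.
  by rewrite /dotc expr2 mulrCA !mulrA lexx.
apply: ler_sum => i _; rewrite mxE mulr_sumr; apply: ler_sum => j _.
apply: (le_trans (ler_norm _)); rewrite !normrM mulrCA.
by apply: ler_pM => //; apply: mulr_ge0.
Qed.

Lemma det_continuous : continuous (fun F => \det F).
Proof.
apply: continuous_big => [p|s _]; first exact: add_continuous.
move=> F; apply: (@cvgM _ _ (nbhs F) _ (fun=> _)); first exact: cvg_cst.
move: F; apply: continuous_big => [p|i _]; first exact: mul_continuous.
by move=> {}F; exact: coord_continuous.
Qed.

Lemma near_det_gt0 F : 0 < \det F -> \forall G \near F, 0 < \det G.
Proof.
move=> F0; have := @det_continuous F; move=> /cvgrPdist_lt/(_ _ F0).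
apply: filterS => G; rewrite ltr_norml => /andP[_]; lra.
Qed.

Lemma near_gram F e : 0 < e ->
  \forall G \near F, forall i j, `|(F *m F^T - G *m G^T) i j| < e.
Proof.
move=> e0.
apply: (@filter_forall _ _ (fun i G => forall j, `|(F *m F^T - G *m G^T) i j| < e)
  (nbhs F) _) => i.
apply: (@filter_forall _ _ (fun j G => `|(F *m F^T - G *m G^T) i j| < e)
  (nbhs F) _) => j.
have c : continuous (fun G : 'M[R]_n => \sum_k G i k * G j k).
  apply: continuous_sum => k G.
  by apply: (@continuousM _ _ (fun G : 'M[R]_n => G i k) (fun G : 'M[R]_n => G j k));
    exact: coord_continuous.
have := c F; move=> /cvgrPdist_lt/(_ _ e0); apply: filterS => G.
congr (`|_| < _); rewrite !mxE; congr (_ - _);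
  by apply: eq_bigr => k _; rewrite mxE.
Qed.

(** Weyl's inequality in both directions controls the squared singular values; their positivity
    transfers the control to the values themselves. *)
Lemma svals_continuous F : 0 < \det F -> {for F, continuous (@svals R n)}.
Proof.
move=> F0; apply/(@cvgrPdist_lt _ _ _ (nbhs F) (nbhs_filter F)) => e e0.
suff : \forall G \near F, forall k, `|svals F 0 k - svals G 0 k| < e.
  apply: filterS => G FG.
  suff : ball (svals F) e (svals G) by rewrite mx_norm_ball.
  by split => // i j; rewrite ord1; exact: FG.
apply: (@filter_forall _ _ (fun k G => `|svals F 0 k - svals G 0 k| < e)
  (nbhs F) _) => k.
have b0 := svals_gt0 k F0; set b := svals F 0 k in b0 *.
(* If [|a ^+ 2 - b ^+ 2| <= r] with [a] and [b] positive, then [|a - b| <= r / (a + b) < e]. The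
   denominator of [s] offsets the factor [n%:R ^+ 2] of [dotc_mulmx_le]. *)
pose r := e * b / 2; have r0 : 0 < r by rewrite divr_gt0// mulr_gt0.
pose s := r / (n%:R ^+ 2 + 1).
have q0 : 0 < n%:R ^+ 2 + 1 :> R by rewrite ltr_wpDl// sqr_ge0.
have s0 : 0 < s by rewrite divr_gt0.
apply: filterS2 (near_det_gt0 F0) (near_gram F s0) => G G0 FG.
have sr : s * n%:R ^+ 2 <= r.
  rewrite /s mulrAC ler_pdivrMr// ler_wpM2l ?ltW//; lra.
have le1 x : dotc x (F *m F^T *m x) <= dotc x (G *m G^T *m x) + r * dotc x x.
  rewrite -lerBlDl -dotcBr -mulmxBl.
  apply: le_trans (dotc_mulmx_le x (fun i j => ltW (FG i j))) _.
  by rewrite ler_wpM2r// dotc_ge0.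
have le2 x : dotc x (G *m G^T *m x) <= dotc x (F *m F^T *m x) + r * dotc x x.
  rewrite -lerBlDl -dotcBr -mulmxBl.
  have GF i j : `|(G *m G^T - F *m F^T) i j| <= s.
    by rewrite -opprB mxE normrN ltW// FG.
  apply: le_trans (dotc_mulmx_le x GF) _.
  by rewrite ler_wpM2r// dotc_ge0.
have := svals_sqr_le F0 G0 le1 k; have := svals_sqr_le G0 F0 le2 k.
have := svals_gt0 k G0; rewrite -/b; set a := svals G 0 k.
rewrite /r ltr_norml => a0 h1 h2; apply/andP; split; nra.
Qed.

End SingularValues.

(** * Derivatives along lines, and continuity from continuous partial derivatives *)

Section Lines.
Local Open Scope classical_set_scope.
Local Open Scope ring_scope.
Variable R : realType.

Lemma derivable_line (V : normedModType R) (f : V -> R) z v (t : R) :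
  derivable (fun s : R => f (z + s *: v)) t 1 <-> derivable f (z + t *: v) v.
Proof.
rewrite /derivable.
suff -> : (fun h : R => h^-1 *: (((fun s : R => f (z + s *: v)) \o shift t) (h *: 1)
      - f (z + t *: v))) =
   (fun h : R => h^-1 *: ((f \o shift (z + t *: v)) (h *: v) - f (z + t *: v))) by [].
apply/funext => h /=; congr (_ *: (f _ - _)).
by rewrite -[h *: 1]/(h * 1) mulr1 scalerDl addrCA.
Qed.

Lemma derive_line (V : normedModType R) (f : V -> R) z v (t : R) :
  'D_1 (fun s : R => f (z + s *: v)) t = 'D_v f (z + t *: v).
Proof.
rewrite /derive.
suff -> : (fun h : R => h^-1 *: (((fun s : R => f (z + s *: v)) \o shift t) (h *: 1)
      - f (z + t *: v))) =
   (fun h : R => h^-1 *: ((f \o shift (z + t *: v)) (h *: v) - f (z + t *: v))) by [].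
apply/funext => h /=; congr (_ *: (f _ - _)).
by rewrite -[h *: 1]/(h * 1) mulr1 scalerDl addrCA.
Qed.

(** Mean value theorem on the segment; [Num.min] and [Num.max] allow either order of the
    endpoints. *)
Lemma derive_bounded_lipschitz (V : normedModType R) (f : V -> R) z v M (a b : R) :
  (forall t, Num.min a b <= t <= Num.max a b ->
    derivable f (z + t *: v) v /\ `|'D_v f (z + t *: v)| <= M) ->
  `|f (z + b *: v) - f (z + a *: v)| <= M * `|b - a|.
Proof.
wlog ab : a b / a <= b.
  move=> wl; have [ab|ba] := orP (le_total a b); first exact: wl.
  by rewrite minC maxC distrC (distrC b); exact: (wl _ _ ba).
rewrite (min_l ab) (max_r ab) => h.
have d t : t \in `[a, b] ->
    is_derive t 1 (fun s : R => f (z + s *: v)) ('D_v f (z + t *: v)).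
  rewrite in_itv/= => /h[dt _]; rewrite -derive_line; apply/derivableP.
  exact/derivable_line.
have d' (t : R) : t \in `]a, b[ ->
    is_derive t 1 (fun s : R => f (z + s *: v)) ('D_v f (z + t *: v)).
  by move=> tab; apply: d; apply: subset_itv_oo_cc tab.
have cphi : {within `[a, b], continuous (fun s : R => f (z + s *: v))}.
  by apply: derivable_within_continuous => t tab; have [] := d t tab.
have [c cab E] := MVT_segment ab d' cphi.
rewrite (E : f (z + b *: v) - f (z + a *: v) = _) normrM ler_wpM2r//.
by have [] := h c cab.
Qed.

(** [C2_on] speaks only of directional derivatives. Continuity of the partial ones bounds them near
    [x], and this gives a Lipschitz estimate at [x] in the 1-norm. *)
Lemma C1_continuous n (O : set 'rV[R]_n) (f : 'rV[R]_n -> R) : open O ->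
  (forall x v, O x -> derivable f x v) ->
  (forall v, {within O, continuous ('D_v f)}) ->
  forall x, O x -> {for x, continuous f}.
Proof.
move=> oO df cf x Ox.
pose e (i : 'I_n) : 'rV[R]_n := delta_mx 0 i.
pose M := \sum_i `|'D_(e i) f x| + 1.
have M0 : 0 < M by rewrite ltr_wpDl// sumr_ge0.
have nearM : \forall y \near x, forall i, `|'D_(e i) f y| <= M.
  apply: (@filter_forall _ _ (fun i y => `|'D_(e i) f y| <= M) (nbhs x) _) => i.
  have := cf (e i); rewrite continuous_open_subspace// => /(_ x).
  rewrite inE => /(_ Ox)/cvgrPdist_lt/(_ _ ltr01); apply: filterS => y xy.
  have : `|'D_(e i) f x| + 1 <= M.
    by rewrite lerD2r (bigD1 i)//= lerDl sumr_ge0.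
  apply: le_trans.
  have -> : 'D_(e i) f y = 'D_(e i) f x - ('D_(e i) f x - 'D_(e i) f y) by ring.
  by apply: le_trans (ler_normB _ _) _; rewrite lerD2l ltW.
have /nbhs_ballP[r r0 xr] : nbhs x [set y | O y /\ forall i, `|'D_(e i) f y| <= M]%classic.
  by apply: filterI => //; exact: open_nbhs_nbhs.
(* walk from [x] to [y] one coordinate at a time *)
have step y (k : nat) : ball x r y -> (k <= n)%N ->
    `|f (\row_j (if (j < k)%N then y 0 j else x 0 j)) - f x| <= M * \sum_j `|y 0 j - x 0 j|.
  move=> [_ xy] kn.
  have : `|f (\row_j (if (j < k)%N then y 0 j else x 0 j)) - f x| <=
      M * \sum_(j < n | (j < k)%N) `|y 0 j - x 0 j|.
    elim: k kn => [_|k IHk kn].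
      rewrite [\row_j _](_ : _ = x) ?subrr ?normr0; last by apply/rowP => j; rewrite mxE.
      by apply: mulr_ge0; [exact: ltW | exact: sumr_ge0].
    pose k0 := Ordinal kn.
    (* Coordinate [k] is cleared so that both ends of the current step lie on the line through [z]
       in direction [e k0]. *)
    pose z := \row_j (if (j < k)%N then y 0 j else if j == k0 then 0 else x 0 j).
    have zE c : z + c *: e k0 = \row_j (if (j < k)%N then y 0 j else if j == k0 then c else x 0 j).
      apply/rowP => j; rewrite !mxE eqxx /=; case: eqP => [->|_] /=.
        by rewrite ltnn add0r mulr1.
      by rewrite mulr0 addr0.
    have z1 : \row_j (if (j < k.+1)%N then y 0 j else x 0 j) = z + y 0 k0 *: e k0.
      rewrite zE; apply/rowP => j; rewrite !mxE ltnS leq_eqVlt -(inj_eq val_inj) /=.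
      case: ltngtP => //= jk; last by congr (y 0 _); exact: val_inj.
    have z0 : \row_j (if (j < k)%N then y 0 j else x 0 j) = z + x 0 k0 *: e k0.
      rewrite zE; apply/rowP => j; rewrite !mxE -(inj_eq val_inj) /=.
      by case: ltngtP => //= jk; congr (x 0 _); exact: val_inj.
    rewrite (bigD1 k0)//= (eq_bigl (fun j : 'I_n => (j < k)%N)); last first.
      by move=> j; rewrite ltnS -(inj_eq val_inj) /= ltn_neqAle andbC.
    rewrite mulrDr -[X in `|X|](subrKA (f (z + x 0 k0 *: e k0))).
    apply: le_trans (ler_normD _ _) _; apply: lerD; last first.
      by rewrite -z0; apply: IHk; exact: ltnW.
    rewrite z1; apply: derive_bounded_lipschitz => t tk.
    (* Balls are boxes for the entrywise norm, so they contain every point whose coordinates lie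
       between those of [x] and [y]. *)
    suff /xr[Oz zM] : ball x r (z + t *: e k0) by split => //; exact: df.
    split => // i j; rewrite ord1 zE mxE; case: ifP => // _.
    case: eqP => [->|_]; last exact: ballxx.
    have := xy 0 k0; rewrite /ball/= !ltr_norml => /andP[h1 h2].
    by move: tk; rewrite ge_min le_max => /andP[] /orP[] ? /orP[] ?; lra.
  move=> /le_trans; apply; apply: ler_wpM2l; first exact: ltW.
  rewrite [leRHS](bigID (fun j : 'I_n => (j < k)%N))/=.
  by rewrite lerDl sumr_ge0.
apply/(@cvgrPdist_lt _ _ _ (nbhs x) (nbhs_filter x)) => eps eps0.
have : nbhs x [set y : 'rV[R]_n | \sum_j `|y 0 j - x 0 j| < eps / M].
  have c : {for x, continuous (fun y : 'rV[R]_n => \sum_j `|y 0 j - x 0 j|)}.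
    apply: continuous_sum => j y.
    apply: (@continuous_comp _ _ _ (fun y : 'rV[R]_n => y 0 j - x 0 j) (fun u : R => `|u|)); last first.
      exact: norm_continuous.
    apply: (@continuousB _ _ _ (fun y : 'rV[R]_n => y 0 j) (fun=> x 0 j)).
      exact: coord_continuous.
    exact: cst_continuous.
  move: c => /cvgrPdist_lt/(_ _ (divr_gt0 eps0 M0)); apply: filterS => y /=.
  rewrite (big1 _ _ (fun j => `|x 0 j - x 0 j|)) => [|j _]; last by rewrite subrr normr0.
  by rewrite sub0r normrN ger0_norm// sumr_ge0.
move=> near1; have near2 : nbhs x (ball x r) by exact: nbhsx_ballx.
apply: filterS2 near1 near2 => y yeps xy.
have := step y n xy (leqnn n).
rewrite [\row_j _](_ : _ = y); last by apply/rowP => j; rewrite mxE ltn_ord.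
rewrite distrC => /le_lt_trans; apply.
by rewrite mulrC -ltr_pdivlMr.
Qed.

End Lines.

(** * Generic lines avoid multiple singular values *)

Section Genericity.
Variables (R : realType) (n : nat).
Implicit Types (F U K : 'M[R]_n) (d : 'rV[R]_n).

(* The eigenvalues of [diag d + c c^T] can only coincide at some [d i] with
   [c i = 0] that is also a root of the secular equation of the other entries. *)
Lemma rank1_update_double (c d x y : 'I_n -> R) (mu : R) :
  injective d ->
  (forall j, d j * x j + c j * (\sum_k c k * x k) = mu * x j) ->
  (forall j, d j * y j + c j * (\sum_k c k * y k) = mu * y j) ->
  \sum_k x k * y k = 0 -> 0 < \sum_k x k ^+ 2 -> 0 < \sum_k y k ^+ 2 ->
  exists i, c i = 0 /\ 1 + \sum_(j | j != i) c j ^+ 2 / (d j - d i) = 0.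
Proof.
move=> dI ex ey xy0 x0 y0.
have nz (z : 'I_n -> R) : \sum_k z k ^+ 2 != 0 -> exists i, z i != 0.
  move=> s0; apply/existsP; apply: contraNT s0 => /existsPn z0.
  by rewrite big1// => k _; have := z0 k; rewrite negbK => /eqP->; rewrite expr0n.
have supp (z : 'I_n -> R) i k :
    (forall j, d j * z j = mu * z j) -> z i != 0 -> k != i -> z k = 0.
  move=> ez zi ki; apply/eqP; apply: contraNT ki => zk; apply/eqP/dI.
  by rewrite (mulIf zi (ez i)) (mulIf zk (ez k)).
(* If both [x] and [y] were orthogonal to [c], they would be eigenvectors of [diag d] for the same
   simple eigenvalue, hence proportional, against [xy0]. *)
wlog a0 : x y ex ey xy0 x0 y0 / \sum_k c k * x k != 0.
  move=> wl; have [a0|] := eqVneq (\sum_k c k * x k) 0; last exact: (wl x y).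
  have [b0|] := eqVneq (\sum_k c k * y k) 0; last first.
    apply: (wl y x) => //.
    by rewrite -[RHS]xy0; apply: eq_bigr => k _; rewrite mulrC.
  have [i xi] := nz x (lt0r_neq0 x0); have [k yk] := nz y (lt0r_neq0 y0).
  have ex' j : d j * x j = mu * x j by rewrite -ex a0 mulr0 addr0.
  have ey' j : d j * y j = mu * y j by rewrite -ey b0 mulr0 addr0.
  have ik : i = k by apply: dI; rewrite (mulIf xi (ex' i)) (mulIf yk (ey' k)).
  move: xy0; rewrite (bigD1 i)//= big1 => [|j ji]; last by rewrite (supp x i)// mul0r.
  by rewrite addr0 => /eqP; rewrite mulf_eq0 (negbTE xi) ik (negbTE yk).
set a := \sum_k c k * x k in ex a0; set b := \sum_k c k * y k in ey.
(* This combination is orthogonal to [c], so it is an eigenvector of [diag d], nonzero since its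
   product with [y] is not 0. As [d] is injective, [z] lives on a single index [i], and
   orthogonality to [c] then forces [c i = 0]. *)
pose z j := b * x j - a * y j.
have ez j : d j * z j = mu * z j.
  have -> : mu * z j = b * (mu * x j) - a * (mu * y j) by rewrite /z; ring.
  by rewrite -ex -ey /z; ring.
have zy : \sum_k z k * y k = - a * \sum_k y k ^+ 2.
  transitivity (b * (\sum_k x k * y k) - a * \sum_k y k ^+ 2).
    by rewrite !mulr_sumr -sumrB; apply: eq_bigr => k _; rewrite /z; ring.
  by rewrite xy0 mulr0 add0r mulNr.
have [i zi] : exists i, z i != 0.
  apply: nz; apply: contra_neq a0 => /psumr_eq0P z0.
  apply/eqP; have : - a * \sum_k y k ^+ 2 == 0.
    rewrite -zy big1// => k _; have /eqP := z0 (fun=> fun=> sqr_ge0 _) k isT.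
    by rewrite sqrf_eq0 => /eqP->; rewrite mul0r.
  by rewrite mulf_eq0 oppr_eq0 (gt_eqF y0) orbF.
have cz : \sum_k c k * z k = 0.
  transitivity (b * a - a * b); last by ring.
  by rewrite /a /b !mulr_sumr -sumrB; apply: eq_bigr => k _; rewrite /z -/a -/b; ring.
have ci : c i = 0.
  move: cz; rewrite (bigD1 i)//= big1 => [|j ji]; last by rewrite (supp z i)// mulr0.
  by rewrite addr0 => /eqP; rewrite mulf_eq0 (negbTE zi) orbF => /eqP.
have di : d i = mu by have := mulIf zi (ez i).
exists i; split => //.
(* The eigenvalue equation with [mu = d i] solves for [x j]; inserting this in the definition of [a]
   gives the secular equation. *)
have -> : \sum_(j | j != i) c j ^+ 2 / (d j - d i) = \sum_(j | j != i) - a^-1 * (c j * x j).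
  apply: eq_bigr => j ji.
  have dji : d j - d i != 0 by rewrite subr_eq0 (inj_eq dI).
  have -> : x j = - (c j * a) / (d j - d i).
    apply: (mulIf dji); rewrite divfK//.
    have -> : x j * (d j - d i) = d j * x j - mu * x j by rewrite di; ring.
    by rewrite -ex; ring.
  by field; rewrite dji a0.
rewrite -mulr_sumr.
have -> : \sum_(j | j != i) c j * x j = a.
  by rewrite /a [in RHS](bigD1 i)//= ci mul0r add0r.
by rewrite mulNr mulVf// subrr.
Qed.

(** The [size p] distinct points [e / (k + 2)], all strictly between 0 and [e], cannot all be roots
    of [p]. *)
Lemma poly_neq0_near0 (p : {poly R}) (e : R) : p != 0 -> 0 < e ->
  exists s, [/\ 0 < s, s < e & p.[s] != 0].
Proof.
move=> p0 e0; pose u (k : nat) : R := e / k.+2%:R.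
have uI : injective u.
  move=> k l /(mulfI (lt0r_neq0 e0))/invr_inj/eqP.
  by rewrite eqr_nat => /eqP[].
have rs_uniq : uniq [seq u k | k <- iota 0 (size p)].
  by rewrite map_inj_uniq// iota_uniq.
have := contraNN (fun x => max_poly_roots p0 x rs_uniq).
rewrite size_map size_iota ltnn => /(_ isT) /allPn[_ /mapP[k _ ->] pk].
exists (u k); split => //; first by rewrite divr_gt0.
by rewrite ltr_pdivrMr// ltr_pMr// ltr1n.
Qed.

Lemma scale_small K (e : R) : 0 < e ->
  exists2 r : R, 0 < r & forall s, 0 < s -> s < r -> `|s *: K| < e.
Proof.
move=> e0; have K0 : 0 < `|K| + 1 by rewrite ltr_wpDl.
exists (e / (`|K| + 1)); first by rewrite divr_gt0.
move=> s s0; rewrite ltr_pdivlMr// => h.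
rewrite normrZ gtr0_norm//; apply: le_lt_trans h.
by rewrite ler_pM2l// lerDl.
Qed.

(** For a unit vector [eta], the orthogonal projection onto its orthogonal complement. *)
Definition tangent_proj (eta : 'cV[R]_n) : 'M[R]_n := 1%:M - eta *m eta^T.

Section UnitVector.
Variable eta : 'cV[R]_n.
Hypothesis eta1 : dotc eta eta = 1.
Let P := tangent_proj eta.

Lemma tr_tangent_proj : P^T = P.
Proof. by rewrite linearB /= trmx1 trmx_mul trmxK. Qed.

Lemma mul_tr_tangent_proj : eta^T *m P = 0.
Proof. by rewrite mulmxBr mulmx1 mulmxA mul_tr_cV eta1 mul1mx subrr. Qed.

Lemma tangent_projK : P *m P = P.
Proof. by rewrite {1}/P mulmxBl mul1mx -mulmxA mul_tr_tangent_proj mulmx0 subr0. Qed.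

Lemma add_outer_proj F (xi : 'cV[R]_n) : (F + xi *m eta^T) *m P = F *m P.
Proof. by rewrite mulmxDl -mulmxA mul_tr_tangent_proj mulmx0 addr0. Qed.

Lemma add_outer_mul F (xi : 'cV[R]_n) : (F + xi *m eta^T) *m eta = F *m eta + xi.
Proof. by rewrite mulmxDl -mulmxA mul_tr_cV eta1 mulmx1. Qed.

Lemma gram_split F :
  F *m F^T = F *m P *m (F *m P)^T + (F *m eta) *m (F *m eta)^T.
Proof.
rewrite !trmx_mul tr_tangent_proj -!mulmxA (mulmxA P) tangent_projK (mulmxA eta).
by rewrite -mulmxDr -mulmxDl /P subrK mul1mx.
Qed.

(** Multiplying [F] on the left by [U *m diag_mx s *m U^T] keeps the eigenbasis and scales [d] by
    the squares of [s]. With [s] positive and strictly decreasing, sorted eigenvalues become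
    distinct, provided at most one of them is 0. *)
Lemma perturb_simple_proj F (e : R) : F \in unitmx -> 0 < e ->
  exists F1, `|F1 - F| < e /\ exists U d, [/\ U *m U^T = 1%:M, injective (d 0) &
    F1 *m P *m (F1 *m P)^T = U *m diag_mx d *m U^T].
Proof.
move=> uF e0.
have [|U [d [UU FE sd]]] := @sym_spectral R n (F *m P *m (F *m P)^T).
  by rewrite trmx_mul trmxK.
pose u i := U *m delta_mx i (0 : 'I_1).
have Uu i : U^T *m u i = delta_mx i 0 by rewrite mulmxA (orthC UU) mul1mx.
have dE i : d 0 i = dotc (P *m (F^T *m u i)) (P *m (F^T *m u i)).
  have <- : dotc (u i) (F *m P *m (F *m P)^T *m u i) = d 0 i.
    rewrite (dotc_spectral _ FE) Uu (bigD1 i)//= big1 => [|j ji].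
      by rewrite mxE !eqxx expr1n mulr1 addr0.
    by rewrite mxE (negbTE ji) expr0n mulr0.
  by rewrite -(mulmxA (F *m P)) dotc_mulmx trmx_mul tr_tangent_proj -!mulmxA.
have d0 i : 0 <= d 0 i by rewrite dE dotc_ge0.
have dker i : d 0 i = 0 -> exists a, F^T *m u i = a *: eta.
  rewrite dE => /dotc_eq0/eqP; rewrite mulmxBl mul1mx subr_eq0 => /eqP ->.
  by exists (dotc eta (F^T *m u i)); rewrite -mulmxA mul_tr_cV scalar_mxC mul_scalar_mx.
have uFt : F^T \in unitmx by rewrite unitmx_tr.
(* A zero before the last index would make two eigenvalues vanish; by [dker], [F^T] would then send
   two independent vectors into the line of [eta]. *)
have dpos (i j : 'I_n) : (i < j)%N -> 0 < d 0 i.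
  move=> ij; rewrite lt_def d0 andbT; apply/eqP => di.
  have dj : d 0 j = 0.
    by apply/eqP; rewrite eq_le d0 andbT -di sd// ltnW.
  have [a ai] := dker i di; have [b bj] := dker j dj.
  have : F^T *m (b *: u i - a *: u j) = 0.
    by rewrite mulmxBr -!scalemxAr ai bj !scalerA mulrC subrr.
  move=> /(congr1 (mulmx (U^T *m invmx F^T))).
  rewrite mulmx0 -mulmxA (mulKmx uFt) mulmxBr -!scalemxAr !Uu => /colP E.
  have b0 : b = 0.
    have := E i; rewrite !mxE !eqxx -val_eqE /= (ltn_eqF ij).
    by rewrite mulr1 mulr0 subr0.
  have := Uu j; rewrite -(mulKmx uFt (u j)) bj b0 scale0r !mulmx0 => /colP/(_ j).
  by rewrite !mxE !eqxx => /esym/eqP; rewrite oner_eq0.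
(* These positive weights decrease strictly in [i], hence so do the factors [s]. *)
pose N : 'rV[R]_n := \row_i (n - i)%:R.
have [r r0 rK] := scale_small (U *m diag_mx N *m U^T *m F) e0.
pose t := r / 2; have t0 : 0 < t by rewrite divr_gt0.
pose s := \row_i (1 + t * N 0 i).
exists (F + t *: (U *m diag_mx N *m U^T *m F)); split.
  by rewrite addrC addKr rK// /t; lra.
exists U, (\row_i (s 0 i ^+ 2 * d 0 i)); split => //.
  suff inj (i j : 'I_n) : (i < j)%N -> s 0 j ^+ 2 * d 0 j < s 0 i ^+ 2 * d 0 i.
    move=> i j; rewrite !mxE => E; apply/val_inj/eqP.
    move: (inj i j) (inj j i); rewrite !mxE in E *; rewrite E ltxx.
    by case: ltngtP => // _; [move=> /(_ isT) | move=> _ /(_ isT)].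
  move=> ij; have di := dpos _ _ ij; have dij := sd _ _ (ltnW ij).
  have dj := d0 j.
  have sj : 0 < s 0 j by rewrite !mxE ltr_wpDr// mulr_ge0// ltW.
  have sij : s 0 j < s 0 i.
    by rewrite !mxE ltrD2l ltr_pM2l// ltr_nat ltn_sub2l// (ltn_trans ij).
  apply: (@le_lt_trans _ _ (s 0 j ^+ 2 * d 0 i)).
    by rewrite ler_wpM2l// sqr_ge0.
  by rewrite ltr_pM2r// ltrXn2r// ltW.
have -> : F + t *: (U *m diag_mx N *m U^T *m F) = U *m diag_mx s *m U^T *m F.
  have -> : diag_mx s = 1%:M + t *: diag_mx N.
    by apply/matrixP => i j; rewrite !mxE; case: (i == j); rewrite /= ?mulr1n ?mulr0n ?mulr0 ?addr0.
  by rewrite mulmxDr mulmx1 !mulmxDl UU mul1mx -scalemxAr -!scalemxAl.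
have -> : U *m diag_mx s *m U^T *m F *m P *m (U *m diag_mx s *m U^T *m F *m P)^T =
    U *m diag_mx s *m (U^T *m (F *m P *m (F *m P)^T) *m U) *m diag_mx s *m U^T.
  by rewrite !trmx_mul tr_diag_mx trmxK !mulmxA.
have -> : U^T *m (F *m P *m (F *m P)^T) *m U = diag_mx d.
  rewrite FE -[U *m _ *m _]mulmxA [U^T *m _]mulmxA (orthC UU) mul1mx.
  by rewrite -mulmxA (orthC UU) mulmx1.
rewrite -2!(mulmxA U) !mulmx_diag; congr (U *m diag_mx _ *m _).
by apply/rowP => i; rewrite !mxE; ring.
Qed.

(** Adding [s] times [U *m o *m eta^T], with [o] the all-ones vector, shifts every coordinate by
    [s], and only finitely many [s] make some coordinate vanish. *)
Lemma perturb_coord_neq0 F U (e : R) : U *m U^T = 1%:M -> 0 < e ->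
  exists F1, [/\ `|F1 - F| < e, F1 *m P = F *m P &
    forall i, (U^T *m (F1 *m eta)) i 0 != 0].
Proof.
move=> UU e0; pose f := U^T *m (F *m eta).
pose o : 'cV[R]_n := const_mx 1.
have [r r0 rK] := scale_small (U *m o *m eta^T) e0.
pose p : {poly R} := \prod_i ((f i 0)%:P + 'X).
have p0 : p != 0.
  by apply/prodf_neq0 => i _; rewrite addrC -[_%:P]opprK -polyCN polyXsubC_eq0.
have [s [s0 sr ps]] := poly_neq0_near0 p0 r0.
exists (F + s *: (U *m o *m eta^T)); rewrite scalemxAl; split.
- by rewrite addrC addKr -scalemxAl rK.
- by rewrite add_outer_proj.
move=> i; rewrite add_outer_mul mulmxDr -scalemxAr (mulmxA U^T U) (orthC UU) mul1mx.
move: ps; rewrite horner_prod => /prodf_neq0/(_ i isT).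
by rewrite !hornerE /f !mxE mulr1.
Qed.

(** Replacing [F *m eta] by [r *: (F *m eta)] with [r = 1 + s] keeps [F *m P]. The product over [i]
    of [1 + r ^+ 2 * q i] is a polynomial in [s] with value 1 at [s = - 1], so it has non-roots
    arbitrarily close to 0. *)
Lemma perturb_radial F (q : 'I_n -> R) (e : R) : 0 < e ->
  exists F1 r, [/\ `|F1 - F| < e, F1 *m P = F *m P, r != 0,
    F1 *m eta = r *: (F *m eta) & forall i, 1 + r ^+ 2 * q i != 0].
Proof.
move=> e0; have [r r0 rK] := scale_small (F *m eta *m eta^T) e0.
pose p : {poly R} := \prod_i (1 + (1 + 'X) ^+ 2 * (q i)%:P).
have pE s : p.[s] = \prod_i (1 + (1 + s) ^+ 2 * q i).
  by rewrite horner_prod; apply: eq_bigr => i _; rewrite !hornerE.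
have p0 : p != 0.
  apply/eqP => p0; have := pE (-1); rewrite p0 horner0 big1 => [/esym/eqP|i _].
    by rewrite oner_eq0.
  by rewrite subrr expr0n mul0r addr0.
have [s [s0 sr ps]] := poly_neq0_near0 p0 r0.
exists (F + s *: (F *m eta *m eta^T)), (1 + s); split.
- by rewrite addrC addKr rK.
- by rewrite scalemxAl add_outer_proj.
- by rewrite gt_eqF// addr_gt0.
- by rewrite [s *: _]scalemxAl add_outer_mul scalerDl scale1r.
by move=> i; move: ps; rewrite pE => /prodf_neq0/(_ i isT).
Qed.

(** Every eigenspace of the Gram matrix has dimension at most one, phrased through orthogonal
    eigenvectors to match [rank1_update_double]. *)
Definition simple_gram F := forall (x y : 'cV[R]_n) mu,
  F *m F^T *m x = mu *: x -> F *m F^T *m y = mu *: y -> dotc x y = 0 ->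
  x = 0 \/ y = 0.

(** The order of the perturbations matters: the last two keep [F *m P], hence the [U] and [d] fixed
    by the first, and the rescaling keeps nonzero coordinates nonzero. *)
Lemma generic_line F (xi : 'cV[R]_n) (e : R) : F \in unitmx -> 0 < e ->
  exists2 F', `|F' - F| < e & forall t : R, simple_gram (F' + t *: (xi *m eta^T)).
Proof.
move=> uF e0; have e3 : 0 < e / 3 by rewrite divr_gt0.
have [F1 [F1F [U [d [UU dI E1]]]]] := perturb_simple_proj uF e3.
have [F2 [F2F E2 f0]] := perturb_coord_neq0 F1 UU e3.
pose f i := (U^T *m (F2 *m eta)) i 0; pose x' i := (U^T *m xi) i 0.
(* The secular sum at the time when coordinate [i] of [F2 *m eta + t *: xi] vanishes. If [x' i = 0],
   there is no such time, because [f i] is nonzero. *)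
pose q i := \sum_(j | j != i) (f j - f i * x' j / x' i) ^+ 2 / (d 0 j - d 0 i).
have [F3 [r [F3F E3 r0 Er qi]]] := perturb_radial F2 q e3.
exists F3.
  have -> : F3 - F = (F3 - F2) + ((F2 - F1) + (F1 - F)) by rewrite !addrA !subrK.
  apply: le_lt_trans (ler_normD _ _) _.
  have := ler_normD (F2 - F1) (F1 - F); lra.
move=> t x y mu; rewrite gram_split scalemxAl add_outer_proj add_outer_mul E3 E2 E1 Er.
set c := r *: (F2 *m eta) + t *: xi => ex ey xy.
have [->|x0] := eqVneq x 0; first by left.
have [->|y0] := eqVneq y 0; first by right.
exfalso; pose c' i := (U^T *m c) i 0.
have cE i : c' i = r * f i + t * x' i.
  by rewrite /c' /c mulmxDr -!scalemxAr !mxE /f /x' !mxE.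
have coord (z : 'cV[R]_n) : (U *m diag_mx d *m U^T + c *m c^T) *m z = mu *: z -> forall j,
    d 0 j * (U^T *m z) j 0 + c' j * (\sum_k c' k * (U^T *m z) k 0) = mu * (U^T *m z) j 0.
  move=> /(congr1 (mulmx U^T)); rewrite mulmxDl mulmxDr -!mulmxA mul_tr_cV.
  rewrite (mulmxA U^T U) (orthC UU) mul1mx -scalemxAr scalar_mxC mul_scalar_mx -scalemxAr.
  move=> E j; move/colP/(_ j): E; rewrite mxE mul_diag_mx.
  rewrite [X in X + _]mxE [X in _ + X]mxE [X in _ = X]mxE => <-; congr (_ + _).
  by rewrite mulrC -(dotc_orth _ _ UU).
have sq (z : 'cV[R]_n) : \sum_k (U^T *m z) k 0 ^+ 2 = dotc z z.
  by rewrite -(dotc_orth _ _ UU).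
have [|||i [ci sec]] := rank1_update_double dI (coord x ex) (coord y ey).
- by rewrite -[RHS]xy -(dotc_orth _ _ UU).
- by rewrite sq dotc_gt0.
- by rewrite sq dotc_gt0.
have xi0 : x' i != 0.
  apply/eqP => xi0; move: ci; rewrite cE xi0 mulr0 addr0 => /eqP.
  by rewrite mulf_eq0 (negbTE r0) (negbTE (f0 i)).
(* Solving [c' i = 0] for [t] turns the secular sum into [r ^+ 2 * q i], which [qi] excludes. *)
have /eqP := qi i; apply; rewrite -[RHS]sec; congr (_ + _).
rewrite /q mulr_sumr; apply: eq_bigr => j ji.
rewrite mulrA -exprMn; congr (_ ^+ 2 / _); rewrite cE.
have -> : t = - (r * f i) / x' i.
  apply: (mulIf xi0); rewrite divfK//; move: ci; rewrite cE => /eqP.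
  by rewrite addrC addr_eq0 => /eqP.
by field.
Qed.

End UnitVector.

(** Two equal singular values would give two orthogonal columns of [U] with the same eigenvalue. *)
Lemma simple_gram_svals F : 0 < \det F -> simple_gram F -> simple_svals F.
Proof.
move=> F0 sF i j ij.
have [_ [sl [U [V [UU VV FE]]]]] := svalsP F0.
rewrite lt_def sl ?(ltnW ij)// andbT; apply/eqP => lij.
have ev k : F *m F^T *m (U *m delta_mx k (0 : 'I_1)) =
    svals F 0 k ^+ 2 *: (U *m delta_mx k 0).
  rewrite (svd_gram VV FE) -!mulmxA (mulmxA U^T) (orthC UU) mul1mx scalemxAr.
  congr (_ *m _); apply/colP => l; rewrite mul_diag_mx !mxE.
  by case: (l =P k) => [->|_]; rewrite ?mulr0.
have nz k : U *m delta_mx k (0 : 'I_1) != 0.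
  apply/eqP => /(congr1 (mulmx U^T)); rewrite mulmx0 mulmxA (orthC UU) mul1mx.
  by move=> /colP/(_ k); rewrite !mxE !eqxx => /eqP; rewrite oner_eq0.
have evj : F *m F^T *m (U *m delta_mx j (0 : 'I_1)) =
    svals F 0 i ^+ 2 *: (U *m delta_mx j 0) by rewrite (lij : svals F 0 i = svals F 0 j); exact: ev.
have [|/eqP|/eqP] := sF _ _ _ (ev i) evj.
- rewrite -(dotc_orth _ _ UU) !(mulmxA U^T) (orthC UU) !mul1mx.
  rewrite /dotc big1// => k _; rewrite !mxE.
  have [->|_] := eqVneq k i; last by rewrite mul0r.
  have /negbTE-> : i != j by rewrite -val_eqE neq_ltn ij.
  by rewrite mulr0.
- by rewrite (negbTE (nz _)).
- by rewrite (negbTE (nz _)).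
Qed.

End Genericity.

(** * Convexity along lines and rank-one convexity *)

Section RankOneConvexity.
Local Open Scope classical_set_scope.
Local Open Scope ring_scope.
Variable R : realType.

(** After transposing and rotating [eta] to the first basis vector, only the first row depends on
    [t], and the determinant is linear in that row. *)
Lemma det_add_outer n (F : 'M[R]_n) (xi eta : 'cV[R]_n) (t : R) : dotc eta eta = 1 ->
  \det (F + t *: (xi *m eta^T)) = (1 - t) * \det F + t * \det (F + xi *m eta^T).
Proof.
case: n F xi eta => [|n] F xi eta eta1.
  by rewrite !det_mx00; ring.
have [Q [QQ Qe]] := orth_first_col eta1.
have Qeta : Q^T *m eta = delta_mx 0 0 by rewrite -Qe mulmxA (orthC QQ) mul1mx.
have Q0 : \det Q != 0.
  apply/eqP => Q0; have /(congr1 determinant) := QQ.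
  by rewrite det_mulmx Q0 mul0r det1 => /esym/eqP; rewrite oner_eq0.
apply: (mulfI Q0); rewrite mulrDr !(mulrCA (\det Q)).
rewrite -[\det Q]det_tr -!(det_tr (F + _)) -!(det_tr F) -!det_mulmx.
set B := Q^T *m F^T; pose X : 'M[R]_n.+1 := delta_mx 0 0 *m xi^T.
have BE s : Q^T *m (F + s *: (xi *m eta^T))^T = B + s *: X.
  by rewrite linearD linearZ /= trmx_mul trmxK mulmxDr -scalemxAr mulmxA Qeta.
have := BE 1; rewrite !scale1r BE => ->.
have X0 : row' 0 X = 0.
  apply/matrixP => i j; rewrite !mxE big1// => k _; rewrite !mxE.
  by rewrite ord1 eq_sym (negbTE (neq_lift _ _)) mul0r.
apply: (@determinant_multilinear _ _ _ _ _ 0).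
- by clearbody B X; apply/rowP => j; rewrite !mxE; ring.
- by rewrite linearD linearZ /= X0 scaler0 addr0.
- by rewrite !linearD linearZ /= X0 scaler0.
Qed.

Lemma line_convex n (W : 'M[R]_n -> R) (F H : 'M[R]_n) :
  (forall t : R, 0 <= t <= 1 -> twice_differentiable_at W (F + t *: H) /\
    0 <= D2 W (F + t *: H) H H) ->
  forall t : R, 0 <= t <= 1 -> W (F + t *: H) <= (1 - t) * W F + t * W (F + H).
Proof.
move=> hW t /andP[t0 t1].
pose h (s : R) : R := W (F + s *: H).
have dW (s : R) : 0 <= s <= 1 -> differentiable W (F + s *: H).
  by move=> /hW[[dWs _] _]; exact: nbhs_singleton dWs.
have dh (s : R) : 0 <= s <= 1 -> derivable h s 1.
  by move=> /dW dWs; apply/derivable_line/diff_derivable.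
have ch (s : R) : 0 <= s <= 1 -> {for s, continuous h}.
  by move=> /dh/derivable1_diffP/differentiable_continuous.
have Dh (s : R) : 0 <= s <= 1 -> 'D_1 h s = 'd W (F + s *: H) H.
  by move=> /dW dWs; rewrite derive_line deriveE.
(* Differentiating once more requires the formula on a neighbourhood of [s], hence the open
   interval. *)
have nearDh (s : R) : 0 < s < 1 -> {near s, 'D_1 h =1 (fun u : R => 'd W (F + u *: H) H)}.
  move=> /andP[s0 s1]; near=> u; apply: Dh; apply/andP; split; apply: ltW.
    by near: u; exact: lt_nbhsr.
  by near: u; exact: lt_nbhsl.
have d2W (s : R) : 0 < s < 1 -> derivable (fun u : R => 'd W (F + u *: H) H) s 1.
  move=> /andP[/ltW s0 /ltW s1]; apply/(derivable_line (fun G => 'd W G H)).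
  by apply: diff_derivable; have [|[_ d2] _] := hW s; rewrite ?s0.
have D2h (s : R) : 0 < s < 1 -> 'D_1 ('D_1 h) s = D2 W (F + s *: H) H H.
  move=> s01; rewrite (near_eq_derive _ (nearDh s s01)).
  rewrite (derive_line (fun G => 'd W G H)) deriveE//.
  by case/andP: s01 => /ltW s0 /ltW s1; have [|[_ d2] _] := hW s; rewrite ?s0.
have s0 : 0 <= 1 - t by rewrite subr_ge0.
have s1 : 1 - t <= 1 by rewrite gerBl.
have D2h_ge0 (s : R) : 0 < s < 1 -> 0 <= 'D_1 ('D_1 h) s.
  move=> s01; rewrite D2h//; case/andP: s01 => /ltW ? /ltW ?.
  by have [|_] := hW s; [apply/andP|].
have chl : h @ (1 : R)^'- --> h 1.
  by apply: cvg_at_left_filter; apply: ch; rewrite ler01 lexx.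
have chr : h @ (0 : R)^'+ --> h 0.
  by apply: cvg_at_right_filter; apply: ch; rewrite ler01 lexx.
have dh01 : {in `]0, 1[, forall s : R, derivable h s 1}.
  by move=> s; rewrite in_itv/= => /andP[/ltW ? /ltW ?]; apply/dh/andP.
have d2h01 : {in `]0, 1[, forall s : R, derivable ('D_1 h) s 1}.
  move=> s; rewrite in_itv/= => s01; apply: near_eq_derivable (d2W s s01).
  by apply: filterS (nearDh s s01) => u ->.
(* The weight [1 - t] belongs to the endpoint 0, so the combination of 0 and 1 is [t]. *)
have := second_derivative_convex D2h_ge0 chl chr dh01 d2h01 (Itv01 s0 s1) ler01.
by rewrite !convRE /= /unstable.onem subKr mulr0 add0r mulr1 /h scale0r addr0 scale1r.
Unshelve. all: by end_near. Qed.

(** Near [F] the determinant stays positive, so [W] agrees there with the extension [G] composed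
    with [svals], and both are continuous. *)
Lemma isotropic_continuous n (g : 'rV[R]_n -> R) (W : 'M[R]_n -> R) :
  (forall F, 0 < \det F -> W F = g (svals F)) -> C2_Mn g ->
  forall F, 0 < \det F -> {for F, continuous W}.
Proof.
move=> Wg [D [G [oD MD _ [dG cG] Gg]]] F F0.
have WE X : 0 < \det X -> G (svals X) = W X.
  by move=> X0; rewrite Wg// Gg//; exact: svals_Mn.
have cGs : {for F, continuous (G \o @svals R n)}.
  apply: continuous_comp; first exact: svals_continuous.
  apply: (C1_continuous oD) => [x v Dx|v|].
  - by have [] := dG x Dx v v.
  - by have [] := cG v v.
  - exact/MD/svals_Mn.
rewrite /prop_for /continuous_at -(WE F F0).
apply: cvg_trans cGs; apply: (@near_eq_cvg _ _ (nbhs F) (nbhs_filter F)).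
by apply: filterS (near_det_gt0 F0) => X X0; exact: WE.
Qed.

Lemma rank1_outer n (H : 'M[R]_n) : \rank H = 1%N ->
  exists xi eta : 'cV[R]_n, dotc eta eta = 1 /\ H = xi *m eta^T.
Proof.
move=> rk; have := mulmx_base H; have := row_base_free H.
move: (col_base H) (row_base H); rewrite rk => c r rfree cr.
have r0 : r^T != 0.
  by rewrite trmx_eq0; apply: contraTneq rfree => ->; rewrite /row_free mxrank0.
pose s := Num.sqrt (dotc r^T r^T).
have s0 : 0 < s by rewrite sqrtr_gt0 dotc_gt0.
exists (s *: c), (s^-1 *: r^T); split.
  rewrite dotcZl dotcZr -[dotc _ _]sqr_sqrtr ?dotc_ge0// -/s.
  by field; rewrite gt_eqF.
by rewrite linearZ /= trmxK -scalemxAl -scalemxAr scalerA mulfV ?gt_eqF// scale1r cr.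
Qed.

Lemma continuous_add_const n (K F : 'M[R]_n) : {for F, continuous (fun X : 'M[R]_n => X + K)}.
Proof.
apply: (@cvgD _ _ _ (nbhs F) (nbhs_filter F) id (fun=> K)); first exact: cvg_id.
exact: (@cvg_cst _ K _ (nbhs F) (nbhs_filter F)).
Qed.

(** A strict failure at [F] would persist on a whole neighbourhood by continuity, against
    [approx]. *)
Lemma convex_inequality_closed n (W : 'M[R]_n -> R) (F H : 'M[R]_n) (t : R) :
  {for F, continuous W} -> {for F + H, continuous W} -> {for F + t *: H, continuous W} ->
  (forall A, nbhs F A -> exists2 F', A F' &
    W (F' + t *: H) <= (1 - t) * W F' + t * W (F' + H)) ->
  W (F + t *: H) <= (1 - t) * W F + t * W (F + H).
Proof.
move=> cW0 cW1 cWt approx; rewrite leNgt; apply/negP => neg.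
have shift_cvg K : {for F + K, continuous W} -> W (X + K) @[X --> F] --> W (F + K).
  move=> cK; apply: (cvg_comp (fun X => X + K) W _ cK).
  exact: continuous_add_const.
pose gap (X : 'M[R]_n) := (1 - t) * W X + t * W (X + H) - W (X + t *: H).
have cgap : gap X @[X --> F] --> gap F.
  have cst (a : R) : (fun _ : 'M[R]_n => a) @ F --> a.
    exact: (@cvg_cst _ a _ (nbhs F) (nbhs_filter F)).
  apply: cvgB (shift_cvg _ cWt); apply: cvgD (cvgM (cst t) (shift_cvg _ cW1)).
  exact: cvgM (cst (1 - t)) cW0.
have gap0 : 0 < - gap F by rewrite oppr_gt0 subr_lt0.
have /approx[F' gapF'] : nbhs F [set X | gap X < 0].
  move: cgap => /cvgrPdist_lt/(_ _ gap0); apply: filterS => X /=.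
  by rewrite ltr_norml => /andP[+ _]; lra.
by rewrite -subr_ge0 leNgt => /negP; apply.
Qed.

End RankOneConvexity.

Unset Implicit Arguments.

Theorem theorem4p5 (R : realType) (n : nat) (ghat : 'rV[R]_n -> R)
  (W : 'M[R]_n -> R) :
  (forall F : 'M[R]_n, 0 < \det F -> W F = ghat (svals F)) ->
  C2_Mn ghat ->
  (forall F : 'M[R]_n, 0 < \det F -> simple_svals F -> LH_elliptic_at W F) ->
  rank_one_convex W.
Proof.
move=> Wg C2g LH F1 F2 F10 F20 rk t t01.
have [xi [eta [eta1 HE]]] := rank1_outer rk.
have F2E : F2 = F1 + xi *m eta^T by rewrite -HE addrC subrK.
set H := xi *m eta^T in HE F2E.
have -> : (1 - t) *: F1 + t *: F2 = F1 + t *: H.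
  by rewrite F2E scalerDr addrA -scalerDl subrK scale1r.
have det_gt0 (F : 'M[R]_n) (s : R) : 0 < \det F -> 0 < \det (F + H) -> 0 <= s <= 1 ->
    0 < \det (F + s *: H).
  by move=> F0 FH0 s01; rewrite det_add_outer//; nra.
have {}F20 : 0 < \det (F1 + H) by rewrite -F2E.
have cW := isotropic_continuous Wg C2g.
rewrite F2E; apply: convex_inequality_closed => [|||A nA].
- exact: cW.
- exact: cW.
- exact/cW/det_gt0.
have nH : nbhs F1 (fun X => 0 < \det (X + H)).
  exact: (continuous_add_const (K := H) (near_det_gt0 F20)).
(* The radius [e] keeps both endpoints of the shifted segment in the region of positive
   determinant. *)
have /nbhs_ballP[e e0 near_e] :
    nbhs F1 (fun X => A X /\ 0 < \det X /\ 0 < \det (X + H)).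
  by apply: filterI nA _; apply: filterI _ nH; exact: near_det_gt0.
have uF1 : F1 \in unitmx by rewrite unitmxE unitfE gt_eqF.
have [F' F'F1 simple] := generic_line eta1 xi uF1 e0.
have [|AF' [F'0 F'H0]] := near_e F'.
  by rewrite mx_norm_ball /ball_ /= distrC.
exists F' => //; apply: line_convex => // s s01.
have Fs0 := det_gt0 F' s F'0 F'H0 s01.
have [tw ell] := LH _ Fs0 (simple_gram_svals Fs0 (simple s)).
by split => //; exact: ell.
Qed.
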